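(* Let $\mathcal{D}$ be a dyadic grid on $\mathbb{R}$ containing the interval $I^{(0)}=(-1,0)$ (up to endpoints), and for $k\geq1$ let $I^{(k)}$ be the right dyadic child (right half) of $I^{(k-1)}$. The space $H^s_{\mathcal{D}}(\mathbb{R})$ is not an algebra (that is, it is not closed under pointwise multiplication) when $0<s<1/2$. In particular, for $0<s<1/2$ and any $\alpha$ with $s<\alpha<\frac{s}{2}+\frac14$, the function $$f:=\sum_{k=0}^\infty|I^{(k)}|^\alpha h_{I^{(k)}}$$ belongs to $H^s_{\mathcal{D}}(\mathbb{R})$ while $f^2\notin H^s_{\mathcal{D}}(\mathbb{R})$.
   Context: A dyadic grid $\mathcal{D}$ on $\mathbb{R}$ is a collection of intervals such that: (D1) every $I\in\mathcal{D}$ has length $2^k$ for some $k\in\mathbb{Z}$; (D2) for any fixed $k_0\in\mathbb{Z}$, the intervals of $\mathcal{D}$ of length $2^{k_0}$ form a partition of $\mathbb{R}$; (D3) $I\cap J\in\{\varnothing,I,J\}$ for all $I,J\in\mathcal{D}$. $|\cdot|$ denotes Lebesgue measure. For $I\in\mathcal{D}$, $I_+$ and $I_-$ denote the right and left halves of $I$ (the two elements of $\mathcal{D}$ of length $|I|/2$ contained in $I$), and $h_I:=|I|^{-1/2}(\mathbf{1}_{I_+}-\mathbf{1}_{I_-})$ is the Haar function; $\{h_I\}_{I\in\mathcal{D}}$ is an orthonormal basis of $L^2(\mathbb{R})$, and Haar series are understood in $L^2(\mathbb{R})$. With $(f,g):=\int_{\mathbb{R}}fg\,dx$, the space $H^s_{\mathcal{D}}(\mathbb{R})$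 consists of all $f\in L^2(\mathbb{R})$ with $\sum_{I\in\mathcal{D}}|I|^{-2s}|(f,h_I)|^2<\infty$. *)

(* Defs.v *)
From HB Require Import structures.
From mathcomp Require Import all_boot all_order all_algebra.
From mathcomp Require Import all_classical all_reals all_analysis.

Set Implicit Arguments.
Unset Strict Implicit.
Unset Printing Implicit Defensive.

Import Order.TTheory GRing.Theory Num.Theory.
Import numFieldNormedType.Exports.

Local Open Scope classical_set_scope.
Local Open Scope ring_scope.

(* [fine] sends infinite measure to 0, which is never of the form [2 ^ k]. *)
Definition length (R : realType) (I : set R) : R := fine (lebesgue_measure I).

Record dyadic_grid (R : realType) (D : set (set R)) : Prop := DyadicGrid {
  grid_interval : forall I, D I -> is_interval I;
  grid_length : forall I, D I -> exists k : int, length I = 2 ^ k;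
  grid_partition : forall k : int,
    partition [set I | D I /\ length I = 2 ^ k] id [set: R];
  grid_nested : forall I J, D I -> D J ->
    [\/ I `&` J = set0, I `&` J = I | I `&` J = J]
}.

Definition dyadic_child (R : realType) (D : set (set R)) (I J : set R) : Prop :=
  [/\ D J, J `<=` I & length J = length I / 2].

(* The conventions at the endpoints are those of [D], so a half of [I] is
   selected among the elements of [D] instead of being cut out of [I] at its
   midpoint. In a dyadic grid exactly one child of [I] qualifies for each. *)
Definition right_half (R : realType) (D : set (set R)) (I : set R) : set R :=
  xget set0 [set J | dyadic_child D I J /\
                     forall x y, J x -> (I `\` J) y -> y < x].

Definition left_half (R : realType) (D : set (set R)) (I : set R) : set R :=
  xget set0 [set J | dyadic_child D I J /\
                     forall x y, J x -> (I `\` J) y -> x < y].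

Definition haar (R : realType) (D : set (set R)) (I : set R) : R -> R :=
  fun x => length I `^ (- 2^-1) *
           (\1_(right_half D I) x - \1_(left_half D I) x).

Definition inner (R : realType) (f g : R -> R) : R :=
  \int[lebesgue_measure]_x (f x * g x).

(* Elements of L^2 are represented by functions rather than by classes modulo
   a.e. equality; membership in [Hs] below is invariant under a.e. equality of
   measurable functions. *)
Definition L2 (R : realType) : set (R -> R) :=
  [set f | f \in Lfun lebesgue_measure 2%:E].

Definition Hs (R : realType) (D : set (set R)) (s : R) : set (R -> R) :=
  [set f | L2 f /\
    (\esum_(I in D)
       (length I `^ (- (2 * s)) * `|inner f (haar D I)| ^+ 2)%:E < +oo)%E].

Definition L2_sum (R : realType) (u : nat -> R -> R) (f : R -> R) : Prop :=
  L2 f /\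
  'N[lebesgue_measure]_2%:E[EFin \o (fun x => (f x - \sum_(k < n) u k x)%R)]%E
    @[n --> \oo] --> 0%E.

Definition right_descendant (R : realType) (D : set (set R)) (I0 : set R)
  (k : nat) : set R := iter k (right_half D) I0.

(* Main.v *)
Require Import Defs.
From HB Require Import structures.
From mathcomp Require Import all_boot all_order all_algebra.
From mathcomp Require Import all_classical all_reals all_analysis.
From mathcomp Require Import measurable_realfun lra.

(** Write [J k] for the [k]-th right descendant of [I0], so that [J k] has
    length [2 ^- k], and let [f] be the sum of the functions
    [length (J k) `^ alpha * haar D (J k)].

    _Membership._ The Haar functions of [D] are orthonormal ([inner_haar_self],
    [inner_haar_neq]), so the coefficients of [f] are [length (J k) `^ alpha]
    along the chain ([chain_coef]) and [0] elsewhere ([off_chain_coef]).  The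
    [Hs] sum of [f] is therefore geometric, of ratio
    [2 `^ (- 2 * (alpha - s)) < 1] ([chain_Hs]).

    _Non-membership of the square._ For [i < k] the function [haar D (J i)] is
    the positive constant [length (J i) `^ (- 2^-1)] on [J k], so the product of
    [haar D (J i)] and [haar D (J k)] is that constant times [haar D (J k)].
    Consequently the integral of a product of three Haar functions of the chain
    is never negative.  Expanding both factors of [f ^+ 2] thus writes the
    coefficient of [f ^+ 2] on [haar D (J k.+1)] as a double sum of non-negative
    terms, and the single term with indices [k] and [k.+1] already gives the
    lower bound [chain_sqr_coef].  It is so large that, for
    [alpha < s / 2 + 1 / 4], every term but the first of the [Hs] sum of [f ^+ 2]
    along the chain is at least [2 `^ (2 * alpha - 1)], and the sum diverges
    ([chain_sqr_notin_Hs]).  The double expansion is carried out one factor at a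
    time, by testing the series of [f] first against [f * haar D (J k.+1)] and
    then against products of two Haar functions ([inner_chain_ge_term]); only weak
    convergence is used ([inner_L2_sum]), so the argument applies to every
    representative of the sum.

    _Existence of the sum._ Off the null set where all the [J k] meet, the series
    is pointwise a finite sum; Fatou's lemma upgrades pointwise convergence to
    convergence in [L2] ([orthogonal_series_L2_sum]).

    The first assertion is the case of an exponent [alpha] half-way between [s]
    and [s / 2 + 1 / 4], which are in this order exactly when [s < 1 / 2]. *)

Set Implicit Arguments.
Unset Strict Implicit.
Unset Printing Implicit Defensive.

Import Order.TTheory GRing.Theory Num.Theory.
Import numFieldNormedType.Exports.

Local Open Scope classical_set_scope.
Local Open Scope ring_scope.

(** * Geometry of dyadic grids *)

Section Grid.
Context {R : realType} {D : set (set R)} (hD : dyadic_grid D).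
Implicit Types I J L : set R.

Lemma length_gt0 I : D I -> 0 < length I.
Proof. by move=> /(grid_length hD)[k ->]; rewrite exprz_gt0. Qed.

Lemma grid_measurable I : D I -> measurable I.
Proof. by move=> /(grid_interval hD); exact: is_interval_measurable. Qed.

(** A length is a power of [2], hence never the junk value [0] that [fine] gives to
    infinite measures. *)
Lemma grid_measure I : D I -> lebesgue_measure I = (length I)%:E.
Proof.
move=> DI; have := length_gt0 DI; rewrite /length.
by case: lebesgue_measure => //=; rewrite ltxx.
Qed.

Lemma grid_neq0 I : D I -> I !=set0.
Proof.
move=> DI; apply/set0P/eqP => I0; have := length_gt0 DI.
by rewrite I0 /length measure0 ltxx.
Qed.

Lemma grid_length_le I J : D I -> D J -> I `<=` J -> length I <= length J.
Proof.
move=> DI DJ IJ; rewrite -lee_fin -!grid_measure//.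
by apply: le_measure => //; rewrite inE; exact: grid_measurable.
Qed.

(** Which endpoints belong to [I] is left open by the grid, so intervals are
    located only by squeezing them between an open and a closed interval. *)
Lemma grid_ends I : D I -> exists a,
  `]a, (a + length I)[ `<=` I /\ I `<=` `[a, (a + length I)].
Proof.
move=> DI; have l0 := length_gt0 DI.
have /is_intervalP := grid_interval hD DI.
move: (Rhull I) => i IE; have lE := congr1 fine (lebesgue_measure_itv i).
rewrite -IE -/(length I) in lE; rewrite {}lE in l0 *.
case: i l0 IE => [[bl x|[]] [br y|[]]] //=;
  rewrite ?ltxx //; try by case: ifP; rewrite ltxx.
case: ifPn => [xy _|_]; last by rewrite ltxx.
move=> ->; exists x.
have -> : x + fine (y%:E - x%:E)%E = y by rewrite -EFinB /= addrC subrK.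
split => z /=; rewrite !in_itv/= => /andP[xz zy].
  by case: (bl) (br) => -[] /=; rewrite ?xz ?zy ?(ltW xz) ?(ltW zy).
by case: (bl) (br) xz zy => -[] /= xz zy; rewrite ?xz ?zy ?(ltW xz) ?(ltW zy).
Qed.

Lemma grid_eq I J x : D I -> D J -> length I = length J -> I x -> J x -> I = J.
Proof.
move=> DI DJ IJ Ix Jx; have [k Ik] := grid_length hD DI.
have [_ tr _] := grid_partition hD k.
by apply: (tr I J) => /=; rewrite -?IJ //; exists x.
Qed.

(** The grid interval of half the length through [x] meets [I], so it is nested
    with [I], and it is too short to contain [I]. *)
Lemma child_at {I x} : D I -> I x -> exists2 J, dyadic_child D I J & J x.
Proof.
move=> DI Ix; have [k Ik] := grid_length hD DI.
have [cov _ _] := grid_partition hD (k - 1).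
have [J [DJ Jk] Jx] : cover [set J | D J /\ length J = 2 ^ (k - 1)] id x.
  by rewrite cov.
have JI : length J = length I / 2 by rewrite Jk Ik expfzDr// exprN1.
exists J => //; split=> //.
have [IJ|IJ|IJ] := grid_nested hD DI DJ.
- by have : (I `&` J) x by []; rewrite IJ.
- have := grid_length_le DI DJ; rewrite -IJ => /(_ (@subIsetr _ _ _)).
  by rewrite IJ JI => ?; have := length_gt0 DI; lra.
- by rewrite -IJ.
Qed.

(** A child sits exactly on one of the two halves: if it started strictly between
    the left end and the midpoint of [I], the child through a point on its left
    would have to overlap it. *)
Lemma child_ends {I J} a b : D I -> dyadic_child D I J ->
  `]a, (a + length I)[ `<=` I -> I `<=` `[a, (a + length I)] ->
  `]b, (b + length J)[ `<=` J -> J `<=` `[b, (b + length J)] ->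
  b = a \/ b = a + length I / 2.
Proof.
set l := length I => DI cJ aI Ia; have l0 : 0 < l := length_gt0 DI.
have bounds K c : dyadic_child D I K -> `]c, (c + length K)[ `<=` K ->
    a <= c /\ c <= a + l / 2.
  move=> [DK KI ->] cK; rewrite -/l in cK *; split; rewrite leNgt; apply/negP => ca.
    (* A point of [K] to the left of [I]. *)
    pose z := Num.min ((a + c) / 2) (c + l / 4).
    have /Ia : I z.
      apply/KI/cK; rewrite /= in_itv/= /z lt_min gt_min; apply/andP.
      by split; [apply/andP; split; lra | apply/orP; right; lra].
    by rewrite /= in_itv/= /z le_min => /andP[/andP[]]; lra.
  (* A point of [K] to the right of [I]. *)
  pose z := Num.max ((a + l + c + l / 2) / 2) (c + l / 4).
  have /Ia : I z.
    apply/KI/cK; rewrite /= in_itv/= /z gt_max lt_max; apply/andP.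
    by split; [apply/orP; right; lra | apply/andP; split; lra].
  by rewrite /= in_itv/= /z ge_max => /andP[_ /andP[]]; lra.
move=> bJ Jb; have [ab ba] := bounds _ _ cJ bJ.
have [DJ JI JE] := cJ; rewrite JE -/l in bJ Jb.
have [->|bNa] := eqVneq b a; first by left.
have [->|bNm] := eqVneq b (a + l / 2); first by right.
have {}ab : a < b by rewrite lt_neqAle eq_sym bNa.
have {}ba : b < a + l / 2 by rewrite lt_neqAle bNm.
have [|K cK Ky] := @child_at I ((a + b) / 2) DI.
  by apply: aI; rewrite /= in_itv/=; apply/andP; split; lra.
have [DK KI KE] := cK.
have [c [cK' Kc]] := grid_ends DK; have [ac ca] := bounds _ _ cK cK'.
rewrite KE -/l in cK' Kc; have /= := Kc _ Ky; rewrite in_itv/= => /andP[cy yc].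
have KJ : K = J.
  (* They share the midpoint between the left end of [J] and the right end of [K]. *)
  apply: (@grid_eq _ _ ((b + c + l / 2) / 2) DK DJ); first by rewrite KE JE.
    by apply: cK'; rewrite /= in_itv/=; apply/andP; split; lra.
  by apply: bJ; rewrite /= in_itv/=; apply/andP; split; lra.
by have := Ky; rewrite KJ => /Jb; rewrite /= in_itv/= => /andP[]; lra.
Qed.

Lemma grid_halves I : D I -> exists LR : set R * set R,
  [/\ dyadic_child D I LR.1, dyadic_child D I LR.2,
      forall J, dyadic_child D I J -> J = LR.1 \/ J = LR.2 &
      forall x y, LR.1 x -> LR.2 y -> x < y].
Proof.
move=> DI; have l0 := length_gt0 DI; have [a [aI Ia]] := grid_ends DI.
have [|L cL Lx] := @child_at I (a + length I / 4) DI.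
  by apply: aI; rewrite /= in_itv/=; apply/andP; split; lra.
have [|Rr cR Rx] := @child_at I (a + length I * (3 / 4)) DI.
  by apply: aI; rewrite /= in_itv/=; apply/andP; split; lra.
have [DL _ LE] := cL; have [DR _ RE] := cR.
have [b [bL Lb]] := grid_ends DL; have [c [cR' Rc]] := grid_ends DR.
have /= := Lb _ Lx; rewrite in_itv/= LE => /andP[b1 b2].
have /= := Rc _ Rx; rewrite in_itv/= RE => /andP[c1 c2].
have bE : b = a by case: (child_ends DI cL aI Ia bL Lb) => //; lra.
have cE : c = a + length I / 2
  by case: (child_ends DI cR aI Ia cR' Rc) => //; lra.
rewrite RE in cR' Rc; rewrite LE in bL Lb.
exists (L, Rr); split=> //=.
  move=> J cJ; have [DJ _ JE] := cJ; have [d [dJ Jd]] := grid_ends DJ.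
  have := child_ends DI cJ aI Ia dJ Jd; rewrite JE in dJ Jd.
  case=> dE; [left|right]; apply: (@grid_eq _ _ (d + length I / 4)) => //;
    rewrite ?JE ?LE ?RE//; [apply: dJ|apply: bL|apply: dJ|apply: cR'];
    by rewrite /= in_itv/=; apply/andP; split; lra.
move=> x y Lx' Ry; have := Lb _ Lx'; have := Rc _ Ry.
rewrite /= !in_itv/= => /andP[cy yc] /andP[bx xb].
rewrite lt_neqAle; apply/andP; split; last by lra.
apply/eqP => xy; have LR : L = Rr.
  by apply: (@grid_eq _ _ x) => //; rewrite ?LE ?RE ?xy.
by have /= := Lb (a + length I * (3 / 4)); rewrite LR in_itv/= => /(_ Rx) /andP[]; lra.
Qed.

(** The selections defining [right_half] and [left_half] succeed, and the halves
    cover [I] including its endpoints. *)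
Lemma halvesP I : D I ->
  [/\ dyadic_child D I (right_half D I), dyadic_child D I (left_half D I),
      right_half D I `&` left_half D I = set0 &
      left_half D I `|` right_half D I = I].
Proof.
move=> DI; have [[L K] /= [cL cK LK lt]] := grid_halves DI.
have [DL LI _] := cL; have [DK KI _] := cK.
have [xL Lx] := grid_neq0 DL; have [xK Kx] := grid_neq0 DK.
have IE : L `|` K = I.
  apply/seteqP; split => [x [/LI|/KI]//|x Ix].
  by have [J /LK[->|->]] := child_at DI Ix; [left|right].
have notLK x : L x -> K x -> False.
  by move=> Lx1 Kx1; have := lt _ _ Lx1 Kx1; rewrite ltxx.
have rE : right_half D I = K.
  rewrite /right_half; case: xgetP => [J _ /= [/LK[->|//] ltJ]|/(_ K)].
    have := ltJ xL xK Lx; rewrite -IE => /(_ _)/wrap[].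
      by split; [right|move=> /notLK; exact].
    by move=> /ltW; rewrite leNgt lt.
  case; split => // x y Kx'; rewrite -IE => -[[Ly|//] _]; exact: lt.
have lE : left_half D I = L.
  rewrite /left_half; case: xgetP => [J _ /= [/LK[//|->] ltJ]|/(_ L)].
    have := ltJ xK xL Kx; rewrite -IE => /(_ _)/wrap[].
      by split; [left|exact: notLK].
    by move=> /ltW; rewrite leNgt lt.
  case; split => // x y Lx'; rewrite -IE => -[[//|Ky] _]; exact: lt.
rewrite rE lE; split => //.
by apply/seteqP; split => // x [Kx' Lx']; exact: (notLK x).
Qed.

Lemma sub_half I J : D I -> D J -> J `<=` I -> J <> I ->
  J `<=` right_half D I \/ J `<=` left_half D I.
Proof.
move=> DI DJ JI JNI; have [[DR _ _] [DL _ _] _ IE] := halvesP DI.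
have cov x : J x -> left_half D I x \/ right_half D I x by rewrite -IE in JI; exact: JI.
have [JR|JR|JR] := grid_nested hD DJ DR.
- right=> x Jx; have [//|Rx] := cov _ Jx.
  by have : (J `&` right_half D I) x by []; rewrite JR.
- by left; rewrite -JR; exact: subIsetr.
have [JL|JL|JL] := grid_nested hD DJ DL.
- left=> x Jx; have [Lx|//] := cov _ Jx.
  by have : (J `&` left_half D I) x by []; rewrite JL.
- by right; rewrite -JL; exact: subIsetr.
- case: JNI; apply/seteqP; split=> // x; rewrite -IE -JR -JL.
  by case=> -[].
Qed.

End Grid.

Lemma length_unit_itv (R : realType) (D : set (set R)) (I0 : set R) :
  dyadic_grid D -> D I0 -> `](-1), 0[ `<=` I0 -> I0 `<=` `[(-1), 0] ->
  length I0 = 1.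
Proof.
move=> hD DI0 lo hi; have mI0 := grid_measurable hD DI0.
have N10 : (-1 : R) < 0 by rewrite oppr_lt0.
apply/eqP; rewrite eq_le -!lee_fin -(grid_measure hD DI0); apply/andP; split.
  have -> : (1%:E : \bar R) = lebesgue_measure (`[(-1), 0]%classic : set R).
    by rewrite lebesgue_measure_itv /= lte_fin N10 -EFinB sub0r opprK.
  by apply: le_measure; [exact: (mem_set mI0)|apply: mem_set|].
have -> : (1%:E : \bar R) = lebesgue_measure (`](-1), 0[%classic : set R).
  by rewrite lebesgue_measure_itv /= lte_fin N10 -EFinB sub0r opprK.
by apply: le_measure; [apply: mem_set|exact: (mem_set mI0)|].
Qed.

(** * Series and powers of real numbers *)

Section Series.
Context {R : realType}.

Lemma series_single_cvg (v : nat -> R) i :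
  (forall k, k != i -> v k = 0) -> series v @ \oo --> v i.
Proof.
move=> v0; apply: cvg_near_cst; near=> n.
rewrite /series /= (bigD1_seq i) ?iota_uniq//= ?mem_index_iota /=.
  by rewrite big1 ?addr0// => k /v0.
by near: n; exact: nbhs_infty_gt.
Unshelve. all: by end_near. Qed.

Lemma term_le_cvg_series (v : nat -> R) l k :
  (forall i, 0 <= v i) -> series v @ \oo --> l -> v k <= l.
Proof.
move=> v0 vl; apply: (cvgr_to_ge vl); near=> n.
rewrite /series /= (bigD1_seq k) ?iota_uniq//= ?mem_index_iota /=.
  by rewrite lerDl sumr_ge0.
by near: n; exact: nbhs_infty_gt.
Unshelve. all: by end_near. Qed.

Lemma powR_exprn (x e : R) k : 0 <= x -> (x ^+ k) `^ e = (x `^ e) ^+ k.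
Proof.
by move=> x0; rewrite -powR_mulrn// -powRrM mulrC powRrM powR_mulrn ?powR_ge0.
Qed.

End Series.

(** * Square-integrable functions *)

Section SquareIntegrable.
Context {R : realType}.
Local Notation mu := (@lebesgue_measure R).
Implicit Types f g h : R -> R.

Lemma L2_measurable f : L2 f -> measurable_fun setT f.
Proof. by rewrite /L2 /= inE => /andP[]; rewrite inE. Qed.

Lemma Lnorm2E f : 'N[mu]_2%:E[EFin \o f]%E =
  ((\int[mu]_x (f x ^+ 2)%:E) `^ 2^-1)%E.
Proof.
rewrite unlock; congr (_ `^ _)%E; apply: eq_integral => x _ /=.
by rewrite powR_mulrn// real_normK// num_real.
Qed.

Lemma L2P f : measurable_fun setT f ->
  (L2 f <-> (\int[mu]_x (f x ^+ 2)%:E < +oo)%E).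
Proof.
move=> mf; have i0 : (0 <= \int[mu]_x (f x ^+ 2)%:E)%E.
  by apply: integral_ge0 => x _; rewrite lee_fin sqr_ge0.
split=> [|fi].
  by move=> /Lfun2_integrable_sqr /integrable_lty; exact.
rewrite /L2 /= inE; apply/andP; split; rewrite inE//=.
by rewrite /finite_norm Lnorm2E poweR_lty.
Qed.

Let lee12 : (1 <= 2%:E :> \bar R)%E := lee1n 2.

Lemma L2_lin c f g : L2 f -> L2 g -> L2 (fun x => c * f x + g x).
Proof. by move=> lf lg; exact: (Lfun_submod_closed mu lee12).2. Qed.

Lemma L2_0 : L2 (fun _ : R => 0 : R).
Proof. exact: (Lfun_submod_closed mu lee12).1. Qed.

Lemma L2Z c f : L2 f -> L2 (fun x => c * f x).
Proof.
move=> lf; have -> : (fun x => c * f x) = (fun x => c * f x + 0).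
  by apply/funext => x; rewrite addr0.
exact: (L2_lin c lf L2_0).
Qed.

Lemma L2D f g : L2 f -> L2 g -> L2 (fun x => f x + g x).
Proof.
move=> lf lg; have -> : (fun x => f x + g x) = (fun x => 1 * f x + g x).
  by apply/funext => x; rewrite mul1r.
exact: L2_lin.
Qed.

Lemma L2B f g : L2 f -> L2 g -> L2 (fun x => f x - g x).
Proof.
move=> lf lg; have -> : (fun x => f x - g x) = (fun x => -1 * g x + f x).
  by apply/funext => x; rewrite mulN1r addrC.
exact: L2_lin.
Qed.

Lemma L2_sumr (I : Type) (r : seq I) (u : I -> R -> R) :
  (forall i, L2 (u i)) -> L2 (fun x => \sum_(i <- r) u i x).
Proof.
move=> lu; elim: r => [|i r IH].
  by under eq_fun do rewrite big_nil; exact: L2_0.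
under eq_fun do rewrite big_cons /=.
exact: L2D.
Qed.

Lemma L2_mul_bounded M f g : L2 f -> measurable_fun setT g ->
  (forall x, `|g x| <= M) -> L2 (fun x => f x * g x).
Proof.
move=> lf mg gM; have mf := L2_measurable lf.
apply/L2P; first exact: measurable_funM.
have /= fi := integrable_lty measurableT (Lfun2_integrable_sqr (L2Z M lf)).
apply: le_lt_trans fi; apply: ge0_le_integral => //=.
- by move=> x _; rewrite lee_fin sqr_ge0.
- by apply/measurable_EFinP; apply: measurable_funX; exact: measurable_funM.
- by apply/measurable_EFinP; apply: measurable_funX; exact: measurable_funM.
- move=> x _; rewrite lee_fin !exprMn mulrC ler_wpM2r ?sqr_ge0//.
  rewrite -real_normK ?num_real// lerXn2r// ?nnegrE ?(le_trans _ (gM x))//.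
Qed.

Lemma L2_integrable_mul f g : L2 f -> L2 g ->
  mu.-integrable setT (fun x => (f x * g x)%:E).
Proof. by move=> lf lg; exact: (Lfun1_integrable _ _).1 (Lfun2_mul_Lfun1 lf lg). Qed.

Lemma innerC f g : inner f g = inner g f.
Proof. by rewrite /inner; under eq_Rintegral do rewrite mulrC. Qed.

Lemma innerZl c f g : L2 f -> L2 g -> inner (fun x => c * f x) g = c * inner f g.
Proof.
move=> lf lg; rewrite /inner -RintegralZl//; last exact: L2_integrable_mul.
by under eq_Rintegral do rewrite -mulrA.
Qed.

Lemma innerDl f g h : L2 f -> L2 g -> L2 h ->
  inner (fun x => f x + g x) h = inner f h + inner g h.
Proof.
move=> lf lg lh; rewrite /inner -RintegralD//; do 1?exact: L2_integrable_mul.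
by under eq_Rintegral do rewrite mulrDl.
Qed.

Lemma innerBl f g h : L2 f -> L2 g -> L2 h ->
  inner (fun x => f x - g x) h = inner f h - inner g h.
Proof.
move=> lf lg lh; rewrite /inner -RintegralB//; do 1?exact: L2_integrable_mul.
by under eq_Rintegral do rewrite mulrBl.
Qed.

Lemma inner0l g : inner (fun=> 0) g = 0.
Proof.
rewrite /inner; under eq_Rintegral do rewrite mul0r.
by rewrite Rintegral_cst// mul0r.
Qed.

Lemma inner_suml (I : Type) (r : seq I) (u : I -> R -> R) g :
  (forall i, L2 (u i)) -> L2 g ->
  inner (fun x => \sum_(i <- r) u i x) g = \sum_(i <- r) inner (u i) g.
Proof.
move=> lu lg; elim: r => [|i r IH].
  by under eq_fun do rewrite big_nil; rewrite inner0l big_nil.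
under eq_fun do rewrite big_cons /=; rewrite big_cons.
by rewrite innerDl// ?IH//; exact: L2_sumr.
Qed.

(** Pythagoras: the cross terms vanish. *)
Lemma inner_sum_orthogonal (I : eqType) (r : seq I) (u : I -> R -> R) :
  uniq r -> (forall i, L2 (u i)) -> (forall i j, i != j -> inner (u i) (u j) = 0) ->
  inner (fun x => \sum_(i <- r) u i x) (fun x => \sum_(i <- r) u i x) =
  \sum_(i <- r) inner (u i) (u i).
Proof.
move=> ur lu orth; rewrite inner_suml//; last exact: L2_sumr.
apply: eq_big_seq => i ir; rewrite innerC inner_suml//.
rewrite (bigD1_seq i)//= big1 ?addr0// => j ji.
exact: orth.
Qed.

Lemma integral_sqr f : L2 f -> (\int[mu]_x (f x ^+ 2)%:E)%E = (inner f f)%:E.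
Proof.
move=> lf; rewrite /inner /Rintegral fineK; first exact: eq_integral.
by apply: integrable_fin_num => //; exact: L2_integrable_mul.
Qed.

Lemma Lnorm2_lty f : L2 f -> ('N[mu]_2%:E[EFin \o f] < +oo)%E.
Proof. by rewrite /L2/= inE => /andP[_]; rewrite inE. Qed.

Lemma cauchy_schwarz f g : L2 f -> L2 g ->
  (`|inner f g|%:E <= 'N[mu]_2%:E[EFin \o f] * 'N[mu]_2%:E[EFin \o g])%E.
Proof.
move=> lf lg; apply: le_trans (hoelder mu (L2_measurable lf) (L2_measurable lg) _ _ _) => //.
  rewrite Lnorm1 EFin_normr_Rintegral//; last exact: L2_integrable_mul.
  apply: le_abse_integral => //.
  exact: measurable_int (L2_integrable_mul lf lg).
by rewrite [RHS]splitr !div1r.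
Qed.

(** Strong convergence implies weak convergence, by Cauchy-Schwarz. *)
Lemma inner_L2_sum (u : nat -> R -> R) f g : (forall k, L2 (u k)) -> L2 g ->
  L2_sum u f -> series (fun k => inner (u k) g) @ \oo --> inner f g.
Proof.
move=> lu lg [lf uf]; apply/cvgrPdist_le => e e0.
have lS n : L2 (fun x => \sum_(k < n) u k x) by exact: L2_sumr.
have lfS n : L2 (fun x => f x - \sum_(k < n) u k x) by exact: L2B.
have gfin : 'N[mu]_2%:E[EFin \o g]%E \is a fin_num.
  by rewrite ge0_fin_numE ?Lnorm_ge0 ?Lnorm2_lty.
have small : (`|inner f g - series (fun k => inner (u k) g) n|%:E
    @[n --> \oo] --> 0%E)%E.
  have prod0 : ('N[mu]_2%:E[EFin \o (fun x => (f x - \sum_(k < n) u k x)%R)] *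
      'N[mu]_2%:E[EFin \o g])%E @[n --> \oo] --> 0%E.
    by rewrite -[X in _ --> X](mul0e ('N[mu]_2%:E[EFin \o g]%E)); apply: cvgeZr.
  apply: (squeeze_cvge _ (cvg_cst 0%E) prod0).
  apply: nearW => n; rewrite /cst lee_fin normr_ge0 /=.
  have -> : series (fun k => inner (u k) g) n = inner (fun x => \sum_(k < n) u k x) g.
    by rewrite /series /= big_mkord inner_suml.
  by rewrite -innerBl//; exact: cauchy_schwarz.
have /fine_cvg /cvgr0Pnorm_le /(_ e e0) := small.
by apply: filterS => n /=; rewrite normr_id.
Qed.

End SquareIntegrable.

Section RieszFischer.
Context {R : realType}.
Local Notation mu := (@lebesgue_measure R).

(** A Riesz-Fischer theorem for orthogonal series that converge almost
    everywhere.  By orthogonality the squared distance between two partial sums is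
    an increment of the convergent series of squared norms; Fatou's lemma passes to
    the limit in one of the two partial sums. *)
Lemma orthogonal_series_L2_sum (u : nat -> R -> R) (N : set R) :
  (forall k, L2 (u k)) -> (forall i j, i != j -> inner (u i) (u j) = 0) ->
  cvgn (series (fun k => inner (u k) (u k))) ->
  measurable N -> mu N = 0%E ->
  (forall x, ~ N x -> cvgn (series (u ^~ x))) ->
  exists f, L2_sum u f.
Proof.
move=> lu orth cv mN muN cu; pose v k := inner (u k) (u k).
pose l := limn (series v); pose S n x := \sum_(k < n) u k x.
have mC : measurable (~` N) by exact: measurableC.
have lS n : L2 (S n) by exact: L2_sumr.
have mS n : measurable_fun setT (S n) := L2_measurable (lS n).
pose f : R -> R := (fun x => limn (series (u ^~ x))) \_ (~` N).
have Sf x : ~ N x -> S ^~ x @ \oo --> f x.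
  move=> Nx; rewrite /f patchE mem_set//.
  by under eq_fun => n do rewrite /S -(big_mkord xpredT (u ^~ x)); exact: cu.
have mf : measurable_fun setT f.
  apply/(measurable_restrictT _ mC).
  apply: (@measurable_fun_cvg _ _ _ _ S) => [n|x Nx]; first exact: measurable_funTS.
  by have := Sf x Nx; rewrite /f patchE mem_set.
have drop (g : R -> R) : measurable_fun setT g ->
    (\int[mu]_x (g x ^+ 2)%:E = \int[mu]_(x in ~` N) (g x ^+ 2)%:E)%E.
  move=> mg; rewrite (ge0_negligible_integral _ _ _ _ muN)//.
  - by rewrite setTD.
  - by apply/measurable_EFinP; exact: measurable_funX.
  - by move=> x _; rewrite lee_fin sqr_ge0.
have increment m n : (\int[mu]_x ((S (m + n) x - S n x) ^+ 2)%:E =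
    (series v (m + n) - series v n)%:E)%E.
  have SE x : S (m + n) x - S n x = \sum_(i <- index_iota n (m + n)) u i x.
    rewrite /S -!(big_mkord xpredT (u ^~ x)).
    by rewrite (big_cat_nat (leq0n n) (leq_addl m n))/= addrAC subrr add0r.
  rewrite sub_series_geq ?leq_addl//.
  rewrite integral_sqr; last exact: L2B.
  congr (_ %:E).
  have -> : (fun x => S (m + n) x - S n x) =
      fun x => \sum_(i <- index_iota n (m + n)) u i x by exact/funext.
  exact: (inner_sum_orthogonal (iota_uniq _ _)).
have err n : (\int[mu]_x ((f x - S n x) ^+ 2)%:E <= (l - series v n)%:E)%E.
  rewrite drop; last exact: measurable_funB.
  have -> : (\int[mu]_(x in ~` N) ((f x - S n x) ^+ 2)%:E = \int[mu]_(x in ~` N)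
      limn_einf (fun m => ((S (m + n)%N x - S n x) ^+ 2)%:E))%E.
    apply: eq_integral => x /set_mem Nx; apply/esym.
    have cvgx : (fun m => (S (m + n)%N x - S n x) ^+ 2) @ \oo --> (f x - S n x) ^+ 2.
      have cvgS := Sf x Nx; rewrite -(cvg_shiftn n) in cvgS.
      by rewrite !expr2; apply: cvgM; apply: cvgB => //; exact: cvg_cst.
    have cvgE : ((S (m + n)%N x - S n x) ^+ 2)%:E @[m --> \oo] -->
        ((f x - S n x) ^+ 2)%:E by apply: cvg_EFin => //; exact: nearW.
    by rewrite (cvg_limn_einf_sup cvgE).1.
  apply: (le_trans (@fatou _ _ _ mu _ mC
    (fun m x => ((S (m + n)%N x - S n x) ^+ 2)%:E) _ _)).
  - move=> m; apply/measurable_EFinP/measurable_funTS/measurable_funX.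
    exact: (L2_measurable (L2B (lS _) (lS _))).
  - by move=> m x _; rewrite lee_fin sqr_ge0.
  have incrementC m : (\int[mu]_(x in ~` N) ((S (m + n)%N x - S n x) ^+ 2)%:E =
      (series v (m + n) - series v n)%:E)%E.
    by rewrite -increment -drop//; exact: (L2_measurable (L2B (lS _) (lS _))).
  under eq_fun do rewrite incrementC.
  rewrite (_ : limn_einf _ = (l - series v n)%:E)//.
  apply: (cvg_limn_einf_sup _).1; apply: cvg_EFin; first exact: nearW.
  have cvgv : series v @ \oo --> l by exact: cv.
  rewrite -(cvg_shiftn n) in cvgv.
  by apply: cvgB => //; exact: cvg_cst.
have lf : L2 f.
  apply/L2P => //; apply: le_lt_trans (ltry (l - series v 0)).
  have := err 0; under eq_integral do rewrite /S big_ord0 subr0; exact.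
exists f; split=> //.
have sqrt0 : Num.sqrt (l - series v n) @[n --> \oo] --> 0.
  rewrite -[X in _ --> X]sqrtr0; apply: continuous_cvg; first exact: sqrt_continuous.
  by rewrite -(subrr l); apply: cvgB; [exact: cvg_cst|exact: cv].
have sqrt0E : (Num.sqrt (l - series v n))%:E @[n --> \oo] --> 0%E.
  by apply: cvg_EFin => //; exact: nearW.
apply: (squeeze_cvge _ (cvg_cst 0%E) sqrt0E).
apply: nearW => n; rewrite /cst Lnorm_ge0 /=.
have le0 : (0 <= (l - series v n)%:E)%E.
  apply: le_trans (err n); apply: integral_ge0 => x _.
  by rewrite lee_fin sqr_ge0.
rewrite Lnorm2E -powR12_sqrt -?lee_fin// -poweR_EFin.
apply: gt0_ler_poweR => //; rewrite ?in_itv/= ?leey ?andbT//.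
  by apply: integral_ge0 => x _; rewrite lee_fin sqr_ge0.
exact: err.
Qed.

End RieszFischer.

(** * The Haar system of a dyadic grid *)

Section Haar.
Context {R : realType} {D : set (set R)} (hD : dyadic_grid D).
Local Notation mu := (@lebesgue_measure R).
Implicit Types I J : set R.

Lemma powR_half_sqr (x : R) : 0 < x -> (x `^ (- 2^-1)) ^+ 2 = x^-1.
Proof.
move=> x0; rewrite -powR_mulrn ?powR_ge0// -powRrM.
by rewrite mulNr mulVf// powR_inv1// ltW.
Qed.

Lemma grid_indic_L2 I : D I -> L2 (\1_I : R -> R).
Proof.
move=> DI; apply/L2P; first exact: measurable_indic (grid_measurable hD DI).
have -> : (fun x => (\1_I x ^+ 2)%:E) = (fun x : R => (\1_I x)%:E : \bar R).
  by apply/funext => x; rewrite indicE; case: (x \in I); rewrite ?expr1n ?expr0n.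
rewrite integral_indic ?setIT//; last exact: (grid_measurable hD DI).
by rewrite [X in (X < _)%E](_ : _ = (length I)%:E) ?ltry//; exact: (grid_measure hD DI).
Qed.

Lemma inner_indic_sub I J : D I -> J `<=` I -> D J ->
  inner \1_J \1_I = length J.
Proof.
move=> DI JI DJ; rewrite /inner /Rintegral.
have -> : (fun x => (\1_J x * \1_I x)%:E) = (fun x : R => (\1_J x)%:E : \bar R).
  apply/funext => x; rewrite !indicE; have [xJ|_] := boolP (x \in J); rewrite ?mul0r//.
  by have /JI/mem_set -> := set_mem xJ; rewrite mulr1.
by rewrite integral_indic ?setIT//; exact: (grid_measurable hD DJ).
Qed.

Lemma haar_right I x : D I -> right_half D I x ->
  haar D I x = length I `^ (- 2^-1).
Proof.
move=> DI Kx; have [_ _ RL _] := halvesP hD DI.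
rewrite /haar !indicE mem_set// memNset ?subr0 ?mulr1// => Lx.
by have : (right_half D I `&` left_half D I) x by []; rewrite RL.
Qed.

Lemma haar_left I x : D I -> left_half D I x ->
  haar D I x = - length I `^ (- 2^-1).
Proof.
move=> DI Lx; have [_ _ RL _] := halvesP hD DI.
rewrite /haar !indicE [x \in left_half _ _]mem_set// memNset ?sub0r ?mulrN1// => Kx.
by have : (right_half D I `&` left_half D I) x by []; rewrite RL.
Qed.

Lemma haar_out I x : D I -> ~ I x -> haar D I x = 0.
Proof.
move=> DI; have [_ _ _ IE] := halvesP hD DI; rewrite -{1}IE => nI.
by rewrite /haar !indicE !memNset ?subr0 ?mulr0// => ?; apply: nI; [left|right].
Qed.

Lemma haarP I x : D I -> [\/ left_half D I x, right_half D I x | ~ I x].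
Proof.
move=> DI; have [_ _ _ IE] := halvesP hD DI.
have [Ix|] := pselect (I x); last by constructor 3.
by move: Ix; rewrite -{1}IE => -[]; [constructor 1|constructor 2].
Qed.

Lemma haar_sqr I x : D I -> haar D I x ^+ 2 = (length I)^-1 * \1_I x.
Proof.
move=> DI; have [[_ KI _] [_ LI _] _ _] := halvesP hD DI.
have l0 := length_gt0 hD DI; rewrite /indic.
have [Lx|Kx|nx] := haarP x DI.
- by rewrite haar_left// mem_set ?mulr1 ?sqrrN ?powR_half_sqr//; exact: LI.
- by rewrite haar_right// mem_set ?mulr1 ?powR_half_sqr//; exact: KI.
- by rewrite haar_out// memNset// mulr0 expr0n.
Qed.

Lemma haar_le I x : D I -> `|haar D I x| <= length I `^ (- 2^-1).
Proof.
move=> DI; have := powR_ge0 (length I) (- 2^-1); have [Lx|Kx|nx] := haarP x DI.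
- by rewrite haar_left// normrN => /ger0_norm ->.
- by rewrite haar_right// => /ger0_norm ->.
- by rewrite haar_out// normr0.
Qed.

Lemma measurable_haar I : D I -> measurable_fun setT (haar D I).
Proof.
move=> DI; have [[DK _ _] [DL _ _] _ _] := halvesP hD DI.
apply: measurable_funM => //; apply: measurable_funB;
  [exact: measurable_indic (grid_measurable hD DK)
  |exact: measurable_indic (grid_measurable hD DL)].
Qed.

Lemma haar_L2 I : D I -> L2 (haar D I).
Proof.
move=> DI; have [[DK _ _] [DL _ _] _ _] := halvesP hD DI.
by apply: L2Z; apply: L2B; exact: grid_indic_L2.
Qed.

Lemma inner_haar_indic I J : D I -> D J -> I `<=` J -> inner (haar D I) \1_J = 0.
Proof.
move=> DI DJ IJ; have [[DK KI KE] [DL LI LE] _ _] := halvesP hD DI.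
have L2K := grid_indic_L2 DK; have L2L := grid_indic_L2 DL.
have L2J := grid_indic_L2 DJ.
rewrite innerZl ?innerBl//; last exact: L2B.
rewrite !inner_indic_sub// ?KE ?LE ?subrr ?mulr0//; exact: subset_trans IJ.
Qed.

Lemma inner_haar_self I : D I -> inner (haar D I) (haar D I) = 1.
Proof.
move=> DI; have L2I := grid_indic_L2 DI; have l0 := length_gt0 hD DI.
have -> : inner (haar D I) (haar D I) = inner (fun x => (length I)^-1 * \1_I x) \1_I.
  rewrite /inner; apply: eq_Rintegral => x _; rewrite -expr2 haar_sqr// -mulrA.
  by rewrite indicE; case: (x \in I); rewrite ?mulr1 ?mulr0.
by rewrite innerZl// inner_indic_sub// mulVf// gt_eqF.
Qed.

(** A Haar function is constant on every grid interval properly contained in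
    its support, since such an interval lies in one of the two halves. *)
Lemma haar_mul_sub I J : D I -> D J -> J `<=` I -> J <> I ->
  exists c, forall x, haar D I x * haar D J x = c * haar D J x.
Proof.
move=> DI DJ JI JNI; have [JK|JL] := sub_half hD DI DJ JI JNI.
  exists (length I `^ (- 2^-1)) => x.
  by have [/JK Kx|nJx] := pselect (J x); [rewrite haar_right|rewrite (haar_out DJ)// !mulr0].
exists (- length I `^ (- 2^-1)) => x.
by have [/JL Kx|nJx] := pselect (J x); [rewrite haar_left|rewrite (haar_out DJ)// !mulr0].
Qed.

Lemma haar_indic_self J x : D J -> haar D J x * \1_J x = haar D J x.
Proof.
move=> DJ; rewrite indicE; have [/mem_set ->|nJx] := pselect (J x); rewrite ?mulr1//.
by rewrite haar_out// mul0r.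
Qed.

Lemma inner_haar_neq I J : D I -> D J -> I <> J -> inner (haar D I) (haar D J) = 0.
Proof.
have sub A B : D A -> D B -> B `<=` A -> B <> A -> inner (haar D A) (haar D B) = 0.
  move=> DA DB BA BNA; have [c cE] := haar_mul_sub DA DB BA BNA.
  have -> : inner (haar D A) (haar D B) = inner (fun x => c * haar D B x) \1_B.
    rewrite /inner; apply: eq_Rintegral => x _.
    by rewrite cE -mulrA haar_indic_self.
  rewrite innerZl ?inner_haar_indic ?mulr0//; [exact: haar_L2|exact: grid_indic_L2].
move=> DI DJ IJ; have [IJ0|IJ0|IJ0] := grid_nested hD DI DJ.
- rewrite -(inner0l (haar D J)) /inner; apply: eq_Rintegral => x _; rewrite mul0r.
  have [Ix|nIx] := pselect (I x); last by rewrite (haar_out DI)// mul0r.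
  rewrite (haar_out DJ) ?mulr0// => Jx.
  by have : (I `&` J) x by []; rewrite IJ0.
- by rewrite innerC; apply: sub => //; rewrite -IJ0; exact: subIsetr.
- by apply: sub => //; [rewrite -IJ0; exact: subIsetl|exact: nesym].
Qed.

End Haar.

(** * Haar series along a chain of right halves *)

Section Chain.
Context {R : realType} {D : set (set R)} (hD : dyadic_grid D).
Context {I0 : set R} (DI0 : D I0) (lengthI0 : length I0 = 1).
Local Notation J := (right_descendant D I0).

Lemma descendant_grid k : D (J k).
Proof.
by elim: k => //= k IH; have [[]] := halvesP hD IH.
Qed.

Lemma descendant_length k : length (J k) = 2^-1 ^+ k.
Proof.
elim: k => [|k IH]; first by rewrite expr0.
have [[_ _ +] _ _ _] := halvesP hD (descendant_grid k).
by rewrite exprS /= => ->; rewrite IH mulrC.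
Qed.

Lemma descendant_sub i k : (i <= k)%N -> J k `<=` J i.
Proof.
move=> /subnK <-; elim: (k - i)%N => // n IH; rewrite addSn.
apply: subset_trans IH.
by have [[]] := halvesP hD (descendant_grid (n + i)).
Qed.

Lemma descendant_neq i k : (i < k)%N -> J k <> J i.
Proof.
move=> ik ki; have := grid_length_le hD (descendant_grid k) (descendant_grid i.+1).
move=> /(_ (descendant_sub ik)); rewrite ki !descendant_length exprS.
have : (0 : R) < 2^-1 ^+ i by rewrite exprn_gt0.
lra.
Qed.

Lemma descendant_inj : injective J.
Proof.
move=> i k ik; case: (ltngtP i k) => // [/descendant_neq|/descendant_neq];
  by rewrite ik.
Qed.

Lemma haar_ancestor i k x : (i < k)%N -> J k x ->
  haar D (J i) x = length (J i) `^ (- 2^-1).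
Proof. by move=> ik /(descendant_sub ik); apply: (haar_right hD); exact: descendant_grid. Qed.

(** On a chain of right halves the constant value of the larger Haar function on
    the smaller interval is known, and positive: this is the source of all the
    signs below. *)
Lemma haar_mul_ancestor i k x : (i < k)%N ->
  haar D (J i) x * haar D (J k) x = length (J i) `^ (- 2^-1) * haar D (J k) x.
Proof.
move=> ik; have [Jx|nJx] := pselect (J k x); first by rewrite (haar_ancestor ik).
by rewrite (haar_out hD (descendant_grid k))// !mulr0.
Qed.

(** The square of [haar D (J k)] is a multiple of [\1_(J k)], so this is the case of
    two equal indices in a triple product of Haar functions. *)
Lemma inner_haar_descendant_indic_ge0 i k : 0 <= inner (haar D (J i)) \1_(J k).
Proof.
have [ik|ki] := ltnP i k; last first.
  by rewrite (inner_haar_indic hD)//; [exact: descendant_grid..|exact: descendant_sub].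
rewrite /inner; apply: Rintegral_ge0 => x _; rewrite indicE.
have [/set_mem Jx|_] := boolP (x \in J k); last by rewrite mulr0.
by rewrite mulr1 (haar_ancestor ik)// powR_ge0.
Qed.

Variable alpha : R.
Local Notation u := (fun k x => length (J k) `^ alpha * haar D (J k) x).
Variables (f : R -> R) (uf : L2_sum u f).

Let L2u k : L2 (u k).
Proof. by apply: L2Z; apply: (haar_L2 hD); exact: descendant_grid. Qed.

Let L2h k : L2 (haar D (J k)).
Proof. by apply: (haar_L2 hD); exact: descendant_grid. Qed.

Let L2f : L2 f. Proof. by case: uf. Qed.

Let inner_u k g : L2 g -> inner (u k) g = length (J k) `^ alpha * inner (haar D (J k)) g.
Proof. by move=> lg; exact: innerZl. Qed.

Lemma chain_coef k : inner f (haar D (J k)) = length (J k) `^ alpha.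
Proof.
have DJ := descendant_grid k.
have cvg1 := inner_L2_sum L2u (L2h k) uf.
have cvg2 : series (fun i => inner (u i) (haar D (J k))) @ \oo -->
    inner (u k) (haar D (J k)).
  apply: series_single_cvg => i ik; rewrite inner_u// (inner_haar_neq hD) ?mulr0//.
    exact: descendant_grid.
  by move=> /descendant_inj/eqP; rewrite (negPf ik).
by rewrite (cvg_unique (@norm_hausdorff _ _) cvg1 cvg2) inner_u// (inner_haar_self hD)// mulr1.
Qed.

Lemma off_chain_coef K : D K -> (forall k, J k <> K) -> inner f (haar D K) = 0.
Proof.
move=> DK JK; have L2K := haar_L2 hD DK.
have cvg1 := inner_L2_sum L2u L2K uf.
have u0 k : inner (u k) (haar D K) = 0.
  by rewrite inner_u// (inner_haar_neq hD) ?mulr0//; exact: descendant_grid.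
have cvg2 := @series_single_cvg _ (fun i => inner (u i) (haar D K)) 0 (fun k _ => u0 k).
by rewrite (cvg_unique (@norm_hausdorff _ _) cvg1 cvg2) u0.
Qed.

(** The pairings of the terms with [g] form a series of non-negative numbers
    converging to [inner f g]. *)
Lemma inner_chain_ge_term g : L2 g -> (forall k, 0 <= inner (haar D (J k)) g) ->
  forall k, length (J k) `^ alpha * inner (haar D (J k)) g <= inner f g.
Proof.
move=> lg g0 k; rewrite -inner_u//.
apply: term_le_cvg_series (inner_L2_sum L2u lg uf) => i.
by rewrite inner_u// mulr_ge0 ?powR_ge0.
Qed.

(** The coefficient of the square is the pairing of [f] with
    [g = f * haar D (J k.+1)].  All the terms [inner (haar D (J i)) g] are
    non-negative, as pairings of [f] with a product of two Haar functions of the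
    chain, and the term with [i = k] is known exactly because that product is a
    multiple of [haar D (J k.+1)]. *)
Lemma chain_sqr_coef k :
  length (J k) `^ alpha * (length (J k) `^ (- 2^-1) * length (J k.+1) `^ alpha) <=
  inner (fun x => f x ^+ 2) (haar D (J k.+1)).
Proof.
pose g x := f x * haar D (J k.+1) x.
have lg : L2 g.
  apply: (L2_mul_bounded L2f (measurable_haar hD (descendant_grid k.+1))) => x.
  exact: (haar_le hD x (descendant_grid k.+1)).
have -> : inner (fun x => f x ^+ 2) (haar D (J k.+1)) = inner f g.
  by rewrite /inner; apply: eq_Rintegral => x _; rewrite /g expr2 mulrA.
have prodE i : inner (haar D (J i)) g =
    inner (fun x => haar D (J i) x * haar D (J k.+1) x) f.
  by rewrite /inner; apply: eq_Rintegral => x _; rewrite /g mulrA mulrAC.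
have ltE i j : (i < j)%N -> inner (fun x => haar D (J i) x * haar D (J j) x) f =
    length (J i) `^ (- 2^-1) * length (J j) `^ alpha.
  move=> ij; rewrite -chain_coef (innerC f) -innerZl//.
  by rewrite /inner; apply: eq_Rintegral => x _; rewrite haar_mul_ancestor.
rewrite -(ltE k k.+1)// -prodE; apply: inner_chain_ge_term => // i; rewrite prodE.
have [ik|ki|->] := ltngtP i k.+1.
- by rewrite ltE// mulr_ge0 ?powR_ge0.
- rewrite (_ : inner _ f = inner (fun x => haar D (J k.+1) x * haar D (J i) x) f).
    by rewrite ltE// mulr_ge0 ?powR_ge0.
  by rewrite /inner; apply: eq_Rintegral => x _; rewrite (mulrC (haar _ _ _)).
- have DJ := descendant_grid k.+1; have L2J := grid_indic_L2 hD DJ.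
  rewrite (_ : inner _ f = inner (fun x => (length (J k.+1))^-1 * \1_(J k.+1) x) f).
    rewrite innerZl// mulr_ge0 ?invr_ge0 ?(ltW (length_gt0 hD DJ))// innerC.
    apply: le_trans (inner_chain_ge_term L2J _ 0); last first.
      by move=> j; exact: inner_haar_descendant_indic_ge0.
    by rewrite mulr_ge0 ?powR_ge0 ?inner_haar_descendant_indic_ge0.
  by rewrite /inner; apply: eq_Rintegral => x _; rewrite -expr2 (haar_sqr hD).
Qed.

End Chain.

Section ChainSobolev.
Context {R : realType} {D : set (set R)} (hD : dyadic_grid D).
Context {I0 : set R} (DI0 : D I0) (lengthI0 : length I0 = 1).
Local Notation J := (right_descendant D I0).

Lemma esum_chain (a : set R -> \bar R) : (forall K, 0 <= a K)%E ->
  (\esum_(K in D) a K = \sum_(k <oo) a (J k) +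
                        \esum_(K in D `&` ~` range J) a K)%E.
Proof.
move=> a0; rewrite (esumID (range J))//; congr (_ + _)%E.
have -> : D `&` range J = range J.
  by apply: setIidr => _ [k _ <-]; exact: (descendant_grid hD DI0).
rewrite esum_image ?nneseries_esumT// => i k _ _.
exact: (descendant_inj hD DI0 lengthI0).
Qed.

Variables (s alpha : R) (f : R -> R).
Hypothesis uf : L2_sum (fun k x => length (J k) `^ alpha * haar D (J k) x) f.

Lemma chain_Hs : s < alpha -> Hs D s f.
Proof.
move=> sa; split; first by case: uf.
pose r : R := 2^-1 `^ (2 * (alpha - s)).
have r0 : 0 < r by rewrite powR_gt0// invr_gt0.
have r1 : r < 1.
  rewrite [ltRHS](_ : 1 = 1 `^ (2 * (alpha - s))); last by rewrite powR1.
  by rewrite gt0_ltr_powR ?nnegrE ?invr_ge0 ?invf_lt1 ?ltr1n//; lra.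
rewrite esum_chain => [|K]; last by rewrite lee_fin mulr_ge0 ?powR_ge0 ?sqr_ge0.
rewrite [X in (_ + X)%E]esum1 ?adde0; last first.
  move=> K [DK nJ]; rewrite (off_chain_coef hD DI0 uf)//.
    by rewrite normr0 expr0n mulr0.
  by move=> k JK; apply: nJ; exists k.
apply: le_lt_trans (ltry (1 / (1 - r))); apply: lime_le.
  by apply: is_cvg_nneseries => k _ _; rewrite lee_fin mulr_ge0 ?powR_ge0 ?sqr_ge0.
apply: nearW => n; rewrite sumEFin lee_fin.
apply: le_trans (geometric_le_lim n ler01 r0 _); last by rewrite gtr0_norm.
rewrite /series /=; apply: ler_sum => k _.
rewrite (chain_coef hD DI0 lengthI0 uf) real_normK ?num_real//.
rewrite (descendant_length hD DI0 lengthI0) !powR_exprn ?invr_ge0// mul1r.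
have -> : r = 2^-1 `^ (- (2 * s)) * (2^-1 `^ alpha) ^+ 2.
  rewrite -powR_mulrn ?powR_ge0// -powRrM -powRD; last first.
    by rewrite invr_eq0 pnatr_eq0 implybT.
  by congr (_ `^ _); lra.
by rewrite exprMn -!exprM mulnC.
Qed.

(** With [L = length (J k.+1)], the bound of [chain_sqr_coef] makes the term of index
    [J k.+1] at least [2 `^ (2 * alpha - 1) * L `^ (4 * alpha - 1 - 2 * s)]; the
    exponent of [L <= 1] is negative, so the terms stay away from [0]. *)
Lemma chain_sqr_notin_Hs : alpha < s / 2 + 1 / 4 ->
  ~ Hs D s (fun x => f x ^+ 2).
Proof.
move=> sa [_]; rewrite esum_chain => [|K]; last first.
  by rewrite lee_fin mulr_ge0 ?powR_ge0 ?sqr_ge0.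
set S := (X in (X + _)%E); set E := (X in (_ + X)%E).
have E0 : (0 <= E)%E.
  by apply: esum_ge0 => K _; rewrite lee_fin mulr_ge0 ?powR_ge0 ?sqr_ge0.
move=> SEoo; have : (S < +oo)%E by apply: le_lt_trans SEoo; rewrite leeDl.
pose c : R := 2 `^ (2 * alpha - 1).
have c0 : 0 < c by rewrite powR_gt0.
have half0 : (0 : R) < 2^-1 by rewrite invr_gt0.
have term k : c <= length (J k.+1) `^ (- (2 * s)) *
    `|inner (fun x => f x ^+ 2) (haar D (J k.+1))| ^+ 2.
  have := chain_sqr_coef hD DI0 lengthI0 uf k.
  rewrite !(descendant_length hD DI0 lengthI0); set L : R := _ ^+ k.+1.
  have L0 : 0 < L by rewrite exprn_gt0.
  have L1 : L <= 1 by rewrite exprn_ile1// ?invf_le1 ?ler1n// ltW.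
  have -> : 2^-1 ^+ k = 2 * L by rewrite /L exprS mulrA mulfV// mul1r.
  set i := inner _ _; set A := _ * _ => Ai.
  have A0 : 0 <= A by rewrite !mulr_ge0 ?powR_ge0.
  have AE : L `^ (- (2 * s)) * A ^+ 2 = c * L `^ (4 * alpha - 1 - 2 * s).
    have pD (x a b : R) : 0 < x -> x `^ a * x `^ b = x `^ (a + b).
      by move=> x0; rewrite powRD// (gt_eqF x0) implybT.
    have sq (x a : R) : (x `^ a) ^+ 2 = x `^ (a * 2).
      by rewrite powRrM powR_mulrn ?powR_ge0.
    have -> : A = 2 `^ (alpha - 2^-1) * L `^ (2 * alpha - 2^-1).
      rewrite /A mulrA pD ?mulr_gt0// powRM ?(ltW L0)// -mulrA pD//.
      by congr (_ * _ `^ _); lra.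
    rewrite exprMn !sq mulrCA pD//.
    by congr (_ `^ _ * _ `^ _); lra.
  apply: (@le_trans _ _ (L `^ (- (2 * s)) * A ^+ 2)).
    rewrite AE ler_peMr ?(ltW c0)// -[leLHS](powRr0 L) ger_powR ?L0//; lra.
  rewrite ler_wpM2l ?powR_ge0// lerXn2r ?nnegrE//.
  exact: le_trans Ai (ler_norm _).
have Sge n : ((c *+ n)%:E <= S)%E.
  have a0 k : ((0 : R)%:E <= (length (J k) `^ (- (2 * s)) *
      `|inner (fun x => f x ^+ 2) (haar D (J k))| ^+ 2)%:E)%E.
    by rewrite lee_fin mulr_ge0 ?powR_ge0 ?sqr_ge0.
  have := @nneseries_lim_ge _ (fun k => (length (J k) `^ (- (2 * s)) *
    `|inner (fun x => f x ^+ 2) (haar D (J k))| ^+ 2)%:E) xpredT 0 n.+1.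
  move=> /(_ (fun k _ _ => a0 k)); apply: le_trans.
  rewrite big_nat_recl// sumEFin -EFinD lee_fin.
  rewrite ler_wpDl ?mulr_ge0 ?powR_ge0 ?sqr_ge0// -[n in c *+ n]subn0.
  rewrite -sumr_const_nat; exact: ler_sum.
move: (S) Sge => [x| |] Sge // _; last by have := Sge 0.
have x0 : 0 <= x by have := Sge 0; rewrite lee_fin mulr0n.
have := archi_boundP (divr_ge0 x0 (ltW c0)).
by rewrite ltr_pdivrMr// mulrC mulr_natr ltNge -lee_fin Sge.
Qed.

End ChainSobolev.

Section ChainExistence.
Context {R : realType} {D : set (set R)} (hD : dyadic_grid D).
Context {I0 : set R} (DI0 : D I0) (lengthI0 : length I0 = 1).
Local Notation mu := (@lebesgue_measure R).
Local Notation J := (right_descendant D I0).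

(** The chain can shrink to an endpoint belonging to all its members, where the
    series of values may diverge; this set has to be discarded. *)
Lemma chain_intersection_null :
  measurable (\bigcap_k J k) /\ mu (\bigcap_k J k) = 0%E.
Proof.
have mJ k : measurable (J k) by exact: (grid_measurable hD (descendant_grid hD DI0 k)).
have mN : measurable (\bigcap_k J k) by exact: bigcapT_measurable.
split=> //; apply/eqP; rewrite eq_le measure_ge0 andbT.
have half0 : (2^-1 ^+ k : R)%:E @[k --> \oo] --> 0%E.
  apply: cvg_EFin; first exact: nearW.
  by apply: cvg_expr; rewrite ger0_norm ?invr_ge0// invf_lt1// ltr1n.
apply: (cvge_to_ge half0); apply: nearW => k.
rewrite -(descendant_length hD DI0 lengthI0) -(grid_measure hD (descendant_grid hD DI0 k)).
by apply: le_measure; [exact: (mem_set mN)|exact: (mem_set (mJ k))|move=> x /(_ k I)].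
Qed.

Lemma chain_L2_sum_exists (alpha : R) : 0 < alpha ->
  exists f, L2_sum (fun k x => length (J k) `^ alpha * haar D (J k) x) f.
Proof.
move=> alpha0; have [mN muN] := chain_intersection_null.
have DJ k := descendant_grid hD DI0 k; have L2h k := haar_L2 hD (DJ k).
apply: (orthogonal_series_L2_sum _ _ _ mN muN).
- by move=> k; exact: L2Z.
- move=> i j ij; rewrite innerZl//; last exact: L2Z.
  rewrite innerC innerZl// (inner_haar_neq hD) ?mulr0//.
  by move=> /(descendant_inj hD DI0 lengthI0)/esym/eqP; rewrite (negPf ij).
- pose r : R := (2^-1 `^ alpha) ^+ 2.
  have -> : series (fun k => inner (fun x => length (J k) `^ alpha * haar D (J k) x)
      (fun x => length (J k) `^ alpha * haar D (J k) x)) = series (geometric 1 r).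
    congr series; apply/funext => k; rewrite innerZl//; last exact: L2Z.
    rewrite innerC innerZl// (inner_haar_self hD)// mulr1 /= mul1r.
    rewrite (descendant_length hD DI0 lengthI0) powR_exprn ?invr_ge0//.
    by rewrite -expr2 /r -!exprM mulnC.
  apply: is_cvg_geometric_series; rewrite ger0_norm ?sqr_ge0//.
  rewrite expr_lt1// ?powR_ge0// [ltRHS](_ : 1 = 1 `^ alpha); last by rewrite powR1.
  by rewrite gt0_ltr_powR ?nnegrE ?invr_ge0 ?invf_lt1 ?ltr1n.
- move=> x nJx; have [K nJK] : exists K, ~ J K x.
    by apply/not_existsP => JK; apply: nJx => k _; apply: contrapT; exact: JK.
  apply/cvg_ex; exists (series (fun k => length (J k) `^ alpha * haar D (J k) x) K).
  apply: cvg_near_cst; near=> n.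
  have Kn : (K <= n)%N by near: n; exact: nbhs_infty_ge.
  apply/eqP; rewrite -subr_eq0 sub_series_geq// big_nat big1// => k /andP[Kk _].
  rewrite (haar_out hD (DJ k)) ?mulr0// => /(descendant_sub hD DI0 Kk).
  exact: nJK.
Unshelve. all: by end_near. Qed.

End ChainExistence.

(** * The counterexample *)

Theorem proposition10 (R : realType) (D : set (set R)) (I0 : set R)
  (hD : dyadic_grid D) (hDI0 : D I0)
  (hI0 : `](-1), 0[ `<=` I0 /\ I0 `<=` `[(-1), 0]) :
  (forall s : R, 0 < s -> s < 1 / 2 ->
     ~ (forall f g : R -> R, Hs D s f -> Hs D s g -> Hs D s (f \* g)))
  /\
  (forall s alpha : R, 0 < s -> s < 1 / 2 ->
     s < alpha -> alpha < s / 2 + 1 / 4 ->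
     let I := right_descendant D I0 in
     let is_f := L2_sum (fun k x => length (I k) `^ alpha * haar D (I k) x) in
     (exists f, is_f f) /\
     (forall f, is_f f -> Hs D s f /\ ~ Hs D s (fun x => f x ^+ 2))).
Proof.
have lengthI0 : length I0 = 1.
  by case: hI0 => lo hi; exact: (length_unit_itv hD hDI0 lo hi).
have spike (s alpha : R) : 0 < s -> s < alpha -> alpha < s / 2 + 1 / 4 ->
    let is_f := L2_sum (fun k x => length (right_descendant D I0 k) `^ alpha *
                                   haar D (right_descendant D I0 k) x) in
    (exists f, is_f f) /\
    (forall f, is_f f -> Hs D s f /\ ~ Hs D s (fun x => f x ^+ 2)).
  move=> s0 sa al; split.
    exact: (chain_L2_sum_exists hD hDI0 lengthI0 (lt_trans s0 sa)).
  move=> f uf; split; first exact: (chain_Hs hD hDI0 lengthI0 uf sa).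
  exact: (chain_sqr_notin_Hs hD hDI0 lengthI0 uf al).
split=> [s s0 s2 closed|s alpha s0 _]; last exact: spike.
pose alpha := (s + (s / 2 + 1 / 4)) / 2.
have [||[f uf] Hf] := spike s alpha s0; rewrite ?/alpha; [lra..|].
have [fH] := Hf f uf; apply.
have -> : (fun x => f x ^+ 2) = f \* f by apply/funext => x; rewrite expr2.
exact: closed.
Qed.
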